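(* Let $A$ be a bounded normal operator in $\mathcal H$ with spectral measure $E$ and let $x\in\mathcal H$ be such that $(A^kx)_{k\in\mathbb N}$ is a Bessel sequence. Then $x\in E(\overline{\mathbb D})\mathcal H$ (i.e., $\operatorname{supp}(\mu_x)\subset\overline{\mathbb D}$).
   Context: $\mathcal H$ is a complex Hilbert space with scalar product $\langle\cdot,\cdot\rangle$. $\mathbb N$ includes zero. $\overline{\mathbb D}$ is the closed unit disc in $\mathbb C$. A sequence $(y_k)_{k\in\mathbb N}$ in $\mathcal H$ is a Bessel sequence if there is $C>0$ such that $\sum_{k\in\mathbb N}|\langle y,y_k\rangle|^2\le C\|y\|^2$ for all $y\in\mathcal H$. The spectral measure $E$ is defined on the Borel sets of $\mathbb C$ and $\mu_x(\Delta)=\langle E(\Delta)x,x\rangle$. The support of a measure is the set of all points for which every open neighborhood has positive measure. *)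

(* Defs.v *)
From HB Require Import structures.
From mathcomp Require Import all_boot all_order all_algebra.
From mathcomp Require Import complex.
From mathcomp Require Import all_classical all_reals all_analysis.

Set Implicit Arguments.
Unset Strict Implicit.
Unset Printing Implicit Defensive.

Import Order.TTheory GRing.Theory Num.Theory.
Import numFieldNormedType.Exports.

Local Open Scope classical_set_scope.
Local Open Scope ring_scope.
Local Open Scope complex_scope.

(** The inner product is linear in its first argument. *)
Record hilbertSpace (R : realType) := HilbertSpace {
  hilbert_carrier :> completeNormedModType R[i];
  dotp : {dot hilbert_carrier for Num.conj};
  dotp_norm : forall u : hilbert_carrier, `|u| ^+ 2 = dotp u u }.

Notation "''[' u , v ]" := (dotp _ u%R v%R)
  (format "''[' u ,  v ]") : ring_scope.

(** Norms over [R[i]] take their values in [R[i]]; [rnorm] is the same norm as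
    an element of [R]. *)
Definition rnorm (R : realType) (V : normedModType R[i]) (u : V) : R :=
  complex.Re `|u|.

Lemma rnormE (R : realType) (V : normedModType R[i]) (u : V) :
  (rnorm u)%:C = `|u|.
Proof. by rewrite RRe_real ?normr_real. Qed.

Lemma rnorm_ge0 (R : realType) (V : normedModType R[i]) (u : V) : 0 <= rnorm u.
Proof. rewrite -lecR rnormE; exact: normr_ge0. Qed.

Definition cplane (R : realType) := g_sigma_algebraType (@open R[i]^o).

HB.instance Definition _ (R : realType) := Measurable.on (cplane R).

Section Operators.
Variables (R : realType) (H : hilbertSpace R).

Definition is_adjoint (A B : H -> H) := forall u v, '[A u, v] = '[u, B v].

Definition bounded_operator (A : H -> H) :=
  exists C : R, forall u, rnorm (A u) <= C * rnorm u.

(** For a bounded operator the adjoint exists and is unique. *)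
Definition normal_operator (A : H -> H) :=
  exists2 B, is_adjoint A B & A \o B =1 B \o A.

Definition orthogonal_projection (P : {linear H -> H}) :=
  P \o P =1 P /\ is_adjoint P P.

Definition bessel_sequence (y : nat -> H) :=
  exists2 C : R, 0 < C &
    forall u : H, (\sum_(0 <= k <oo) (rnorm ('[u, y k] : R[i]^o) ^+ 2)%:E
                   <= (C * rnorm u ^+ 2)%:E)%E.

(** Projection-valued measures on the Borel sets of the complex plane; the
    values on other sets are irrelevant. Countable additivity is for the strong
    operator topology. *)
Record projectionMeasure := ProjectionMeasure {
  pvm :> set (cplane R) -> {linear H -> H};
  pvm_proj : forall D, measurable D -> orthogonal_projection (pvm D);
  pvm_set0 : pvm set0 =1 cst 0;
  pvm_setT : pvm setT =1 id;
  pvm_setI : forall D1 D2, measurable D1 -> measurable D2 ->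
    pvm (D1 `&` D2) =1 pvm D1 \o pvm D2;
  pvm_sigma_additive : forall (F : nat -> set (cplane R)) (u : H),
    (forall n, measurable (F n)) -> trivIset setT F ->
    series (fun n => pvm (F n) u) @ \oo --> pvm (\bigcup_n F n) u }.

End Operators.

Section CauchySchwarz.
Variables (R : realType) (H : hilbertSpace R).

Lemma dotp_CauchySchwarz (u v : H) : `|'[u, v]| <= `|u| * `|v|.
Proof.
have [->|v0] := eqVneq v 0; first by rewrite linear0r normr0 mulr_ge0.
rewrite -(@ler_pXn2r _ 2) ?nnegrE ?mulr_ge0// exprMn !dotp_norm.
have vgt0 : 0 < '[v, v] by rewrite dnorm_gt0.
have := dnorm_ge0 (dotp H) ('[v, v] *: u - '[u, v] *: v).
rewrite dnormB !dnormZ linearZl_LR linearZr_LR/=.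
rewrite (ger0_norm (ltW vgt0)).
have -> : '[v, v] * ('[u, v]^*%R * '[u, v]) = '[v, v] * `|'[u, v]| ^+ 2.
  by rewrite normCK [X in _ * X]mulrC.
rewrite rmorphM/= rmorphXn/=.
have -> : ('[v, v]^*%R : R[i]) = '[v, v] by apply: geC0_conj; exact: ltW.
have -> : (`|'[u, v]|^*%R : R[i]) = `|'[u, v]| by apply: geC0_conj.
rewrite opprD [`|_| ^+ 2 * _]mulrC addrA addrK expr2 -mulrA -mulrBr.
by rewrite pmulr_rge0// subr_ge0 mulrC.
Qed.

Lemma Re_dotp_cvg (w : nat -> H) (u v : H) : w @ \oo --> u ->
  complex.Re '[w n, v] @[n --> \oo] --> complex.Re '[u, v].
Proof.
move=> wu; apply/cvgrPdist_lt => e e0.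
have c0 : 0 < (e / (1 + rnorm v))%:C.
  by rewrite ltcR divr_gt0// ltr_wpDr// rnorm_ge0.
move/cvgrPdist_lt : wu => /(_ _ c0); apply: filterS => n.
move=> h; rewrite -raddfB/= -linearBl.
rewrite -ltcR; apply: le_lt_trans (normc_ge_Re _) _.
apply: le_lt_trans (dotp_CauchySchwarz _ _) _.
rewrite -(rnormE v); apply: (@le_lt_trans _ _ ((e / (1 + rnorm v))%:C * (rnorm v)%:C)).
  by rewrite ler_wpM2r ?lecR ?rnorm_ge0// ltW.
rewrite -rmorphM/= ltcR mulrAC ltr_pdivrMr; last by rewrite ltr_wpDr ?rnorm_ge0.
by rewrite ltr_pM2l// ltrDr.
Qed.

End CauchySchwarz.

(** [pvm_measure E x D] is '[E D x, x]; the value 0 on non-Borel sets makes it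
    a total set function, as the library's measures are. *)
Definition pvm_measure (R : realType) (H : hilbertSpace R)
    (E : projectionMeasure H) (x : H) (D : set (cplane R)) : \bar R :=
  if `[< measurable D >] then (complex.Re '[E D x, x])%:E else 0%E.

Section PvmMeasure.
Variables (R : realType) (H : hilbertSpace R).
Variables (E : projectionMeasure H) (x : H).
Local Notation mu := (pvm_measure E x).

Lemma pvm_measureE D : measurable D -> mu D = (complex.Re '[E D x, x])%:E.
Proof. by move=> mD; rewrite /pvm_measure asboolT. Qed.

Let mu0 : mu set0 = 0%E.
Proof. by rewrite pvm_measureE// pvm_set0/= linear0l. Qed.

Let mu_ge0 D : (0 <= mu D)%E.
Proof.
rewrite /pvm_measure; case: asboolP => // mD; rewrite lee_fin.
have [idE adjE] := pvm_proj E mD.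
rewrite -(idE x)/= adjE.
by have := dnorm_ge0 (dotp H) (E D x); rewrite lecE => /andP[].
Qed.

Let mu_sigma_additive : semi_sigma_additive mu.
Proof.
move=> F mF tF mUF; rewrite pvm_measureE//.
have -> : (fun n => (\sum_(0 <= i < n) mu (F i))%E) =
    EFin \o (fun n => complex.Re '[series (fun k => E (F k) x) n, x]).
  apply/funext => n; rewrite /series/= linear_sumlz raddf_sum/= -sumEFin.
  by apply: eq_bigr => i _; rewrite pvm_measureE.
apply: cvg_EFin; first by near=> n.
apply: Re_dotp_cvg.
exact: pvm_sigma_additive.
Unshelve. all: by end_near. Qed.

HB.instance Definition _ :=
  isMeasure.Build _ _ _ mu mu0 mu_ge0 mu_sigma_additive.

End PvmMeasure.

Definition complex_integral (R : realType) (mu : {measure set (cplane R) -> \bar R})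
    (f : cplane R -> R[i]) : R[i] :=
  (\int[mu]_(z in setT) complex.Re (f z)) +i*
  (\int[mu]_(z in setT) complex.Im (f z)).

(** [E] is the spectral measure of [A] when it has bounded support and [A] is the
    integral of [z] against [E]. The integral is taken in the weak sense; by
    polarization the quadratic form of [A] determines [A]. *)
Definition spectral_measure_of (R : realType) (H : hilbertSpace R)
    (A : H -> H) (E : projectionMeasure H) :=
  (exists r : R, E [set z : R[i] | `|z| <= r%:C] =1 id) /\
  (forall u : H, '[A u, u] = complex_integral (pvm_measure E u) id).

Definition measure_support (R : realType) (mu : set (cplane R) -> \bar R) :
    set R[i] :=
  [set z | forall U : set R[i]^o, open U -> U z -> (0 < mu U)%E].

Definition closed_unit_disc (R : realType) : set R[i] := [set z | `|z| <= 1].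

Arguments closed_unit_disc R : clear implicits.

(* Main.v *)
Require Import Defs.
From HB Require Import structures.
From mathcomp Require Import all_boot all_order all_algebra.
From mathcomp Require Import complex.
From mathcomp Require Import all_classical all_reals all_analysis.
From mathcomp Require Import measurable_realfun ring lra.

Set Implicit Arguments.
Unset Strict Implicit.
Unset Printing Implicit Defensive.

Import Order.TTheory GRing.Theory Num.Theory.
Import numFieldNormedType.Exports.
Local Open Scope classical_set_scope.
Local Open Scope ring_scope.
Local Open Scope complex_scope.

(** The Bessel bound tested on [A^k x] itself gives [|A^k x|^4 <= C |A^k x|^2],
    so the orbit of [x] is bounded. The projections [E B] commute with [A],
    and on the range of [E B], for [B] the ball of centre [w] and radius [r],
    the quadratic form of [A - w] is at most [2 r] times the squared norm; by
    polarization [|A v - w v| <= 4 r |v|] there. If [|w| - 4 r > 1], the orbit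
    of [E B x] would thus grow geometrically unless [E B x = 0]. Countably many
    such balls cover the complement of the closed unit disc, which is therefore
    null for the measure of [x]. *)

(** * Polarization and the numerical radius *)

Section NumericalRadius.
Context {R : realType} {H : hilbertSpace R}.
Implicit Types (S : {linear H -> H}) (u v y : H).

Lemma dotp_normE u : '[u, u] = ((rnorm u) ^+ 2)%:C.
Proof. by rewrite -dotp_norm -rnormE rmorphXn. Qed.

Lemma dotpBl u v y : '[u - v, y] = '[u, y] - '[v, y].
Proof. exact: linearBl. Qed.

Lemma dotpBr u v y : '[u, v - y] = '[u, v] - '[u, y].
Proof. exact: linearBr. Qed.

Lemma form_line S v y (t : R[i]) :
  '[S (v + t *: y), v + t *: y] =
  '[S v, v] + t^* * '[S v, y] + t * '[S y, v] + t * t^* * '[S y, y].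
Proof.
rewrite linearDr/= linearZr_LR/= linearD linearZ/= !linearDl/= !linearZl_LR/=.
by rewrite /GRing.scale/=; ring.
Qed.

Lemma polarization S v y :
  4 * '[S v, y] = '[S (v + y), v + y] - '[S (v - y), v - y]
    + 'i%C * '[S (v + 'i%C *: y), v + 'i%C *: y]
    - 'i%C * '[S (v - 'i%C *: y), v - 'i%C *: y].
Proof.
have := form_line S v y 1; rewrite scale1r => ->.
have := form_line S v y (-1); rewrite scaleN1r => ->.
have := form_line S v y (- 'i%C); rewrite scaleNr => ->.
rewrite form_line.
have ci : ('i%C^*%R : R[i]) = - 'i%C by apply/eqP; rewrite eq_complex/= oppr0 !eqxx.
have ii : 'i%C * 'i%C = -1 :> R[i] by rewrite -expr2 sqr_i.
by rewrite !rmorphN/= ci rmorph1; ring: ii.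
Qed.

Lemma dotp_parallelogram v y :
  '[v + y, v + y] + '[v - y, v - y] = 2 * ('[v, v] + '[y, y]).
Proof. by rewrite !(linearBl, linearDl, linearBr, linearDr)/=; ring. Qed.

(** Polarization writes [4 * '[S v, y]] with four values of the form; the parallelogram law, for [y]
    and for [i y], adds up the four squared norms. *)
Lemma numerical_radius_dotp S (r : R[i]) :
  (forall u, `|'[S u, u]| <= r * '[u, u]) ->
  forall v y, `|'[S v, y]| <= r * ('[v, v] + '[y, y]).
Proof.
move=> Sr v y.
have n4 : `|4 : R[i]| = 4 by rewrite ger0_norm.
rewrite -(ler_pM2l (_ : 0 < 4 :> R[i]))// -{1}n4 -normrM polarization.
have ni : `|'i%C : R[i]| = 1 by rewrite normc_def/= expr0n/= add0r expr1n sqrtr1.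
apply: le_trans (ler_normB _ _) _.
apply: le_trans (lerD (ler_normD _ _) (lexx _)) _.
apply: le_trans (lerD (lerD (ler_normB _ _) (lexx _)) (lexx _)) _.
rewrite !normrM ni !mul1r.
apply: le_trans (lerD (lerD (lerD (Sr _) (Sr _)) (Sr _)) (Sr _)) _.
rewrite -!mulrDr -addrA dotp_parallelogram dotp_parallelogram.
rewrite [X in _ + 2 * (_ + X)](_ : _ = '[y, y]); last first.
  by rewrite -!dotp_norm normrZ ni mul1r.
by rewrite le_eqVlt; apply/orP; left; apply/eqP; ring.
Qed.

(** The case of bound 0 at [y = S u]: over the complex numbers the form determines the operator. *)
Lemma form_eq0_linear S : (forall u, '[S u, u] = 0) -> forall u, S u = 0.
Proof.
move=> S0 u; apply/eqP; rewrite -(dnorm_eq0 (dotp H)) -normr_eq0.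
rewrite eq_le normr_ge0 andbT.
rewrite -[leRHS](mul0r ('[u, u] + '[S u, S u])).
by apply: numerical_radius_dotp => v; rewrite S0 normr0 mul0r.
Qed.

Lemma numerical_radius_norm S (r : R) : 0 < r ->
  (forall u, `|'[S u, u]| <= r%:C * '[u, u]) ->
  forall u, rnorm (S u) <= 2 * r * rnorm u.
Proof.
move=> r0 Sr u.
(* With the factor [1 / (2 r)] the term in [S u] on the right is half of the left-hand side and can
   be absorbed. *)
have := numerical_radius_dotp Sr u ((2 * r)^-1%:C *: S u).
rewrite linearZr_LR/= [in '[_ *: S u, _]]linearZl_LR linearZr_LR/= !dotp_normE.
have -> (a : R) : (a%:C)^*%R = a%:C :> R[i] by exact: conjc_real.
rewrite -!rmorphM/= -rmorphD/= -rmorphM/= normc_def/= expr0n/= addr0 sqrtr_sqr.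
rewrite lecR => h.
have {h} h : (2 * r)^-1 * rnorm (S u) ^+ 2 <=
   r * (rnorm u ^+ 2 + (2 * r)^-1 * ((2 * r)^-1 * rnorm (S u) ^+ 2)).
  by apply: le_trans h; exact: ler_norm.
rewrite -(@ler_pXn2r _ 2) ?nnegrE ?rnorm_ge0//; last first.
  by rewrite mulr_ge0 ?rnorm_ge0// mulr_ge0// ltW.
have r2 : 0 <= 4 * r by rewrite mulr_ge0// ltW.
have := ler_wpM2l r2 h.
have -> : 4 * r * ((2 * r)^-1 * rnorm (S u) ^+ 2) = 2 * rnorm (S u) ^+ 2.
  by field; rewrite gt_eqF.
have -> : 4 * r * (r * (rnorm u ^+ 2 + (2 * r)^-1 * ((2 * r)^-1 * rnorm (S u) ^+ 2)))
  = (2 * r * rnorm u) ^+ 2 + rnorm (S u) ^+ 2 by field; rewrite gt_eqF.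
by move=> ?; lra.
Qed.

End NumericalRadius.

(** * Borel sets and balls of the complex plane *)

Section ComplexPlane.
Context {R : realType}.
Implicit Types (z w : R[i]) (r : R).

Lemma open_measurable_cplane (U : set R[i]^o) :
  open U -> measurable (U : set (cplane R)).
Proof. by move=> oU; apply: sub_sigma_algebra. Qed.

Lemma rnorm_Re_le z : `|complex.Re z| <= rnorm (z : R[i]^o).
Proof. by rewrite -lecR rnormE; exact: normc_ge_Re. Qed.

Lemma rnorm_Im_le z : `|complex.Im z| <= rnorm (z : R[i]^o).
Proof.
case: z => a b; rewrite /rnorm normc_def/= -sqrtr_sqr.
by rewrite ler_wsqrtr// lerDr sqr_ge0.
Qed.

Lemma rnorm_le_ReIm z : rnorm (z : R[i]^o) <= `|complex.Re z| + `|complex.Im z|.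
Proof.
case: z => a b; rewrite /rnorm normc_def/=.
rewrite -(@ler_pXn2r _ 2) ?nnegrE ?sqrtr_ge0 ?addr_ge0// sqr_sqrtr ?addr_ge0 ?sqr_ge0//.
by rewrite sqrrD !real_normK ?num_real// lerD2r lerDl mulrn_wge0// mulr_ge0.
Qed.

Lemma rnormB_ler (V : normedModType R[i]) (u v : V) :
  rnorm u - rnorm v <= rnorm (u - v).
Proof. by rewrite -lecR rmorphB/= !rnormE; exact: lerB_dist. Qed.

(** Meant for [z] outside the disc and [w] the centre of a small ball that covers [z]. *)
Lemma rnorm_gt_near z w (r s : R) :
  rnorm (w - z : R[i]^o) < r -> s + r < rnorm (z : R[i]^o) ->
  s < rnorm (w : R[i]^o).
Proof.
have := rnormB_ler (z : R[i]^o) (z - w); rewrite subKr.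
have -> : rnorm (w - z : R[i]^o) = rnorm (z - w : R[i]^o) by rewrite /rnorm distrC.
by move=> *; lra.
Qed.

Lemma cplane_ballE w r :
  ball (w : R[i]^o) r%:C = [set z | rnorm (w - z : R[i]^o) < r].
Proof.
by apply/seteqP; split => z; rewrite -ball_normE /ball_/= -rnormE ltcR.
Qed.

Lemma measurable_cplane_ball w r :
  measurable (ball (w : R[i]^o) r%:C : set (cplane R)).
Proof. by apply: open_measurable_cplane; exact: ball_open. Qed.

Lemma open_cplane (U : set R[i]^o) :
  (forall z, U z -> exists2 r, 0 < r &
     forall w, rnorm (z - w : R[i]^o) < r -> U w) -> open U.
Proof.
move=> h; rewrite openE => z /h[r r0 rU].
apply/nbhs_ballP; exists r%:C => /=; first by rewrite ltcR.
by rewrite cplane_ballE => w /= /rU.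
Qed.

Lemma open_rnorm_gt r : open [set z : R[i]^o | r < rnorm z].
Proof.
apply: open_cplane => z /= rz; exists (rnorm (z : R[i]^o) - r).
  by rewrite subr_gt0.
move=> w zw; have := rnormB_ler (z : R[i]^o) (z - w).
by rewrite subKr; lra.
Qed.

Lemma closed_discE r :
  [set z : R[i] | `|z| <= r%:C] = ~` [set z : R[i]^o | r < rnorm z].
Proof.
by apply/seteqP; split => z /=; rewrite -(rnormE (z : R[i]^o)) lecR leNgt => /negP.
Qed.

Lemma measurable_closed_disc r :
  measurable ([set z | `|z| <= r%:C] : set (cplane R)).
Proof.
rewrite closed_discE; apply: measurableC.
by apply: open_measurable_cplane; exact: open_rnorm_gt.
Qed.

(** Such a function pulls open intervals back to open sets, and open intervals generate the Borel
    sets of the line. *)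
Lemma measurable_cplane (f : cplane R -> R) :
  (forall z w : R[i], `|f z - f w| <= rnorm (z - w : R[i]^o)) ->
  measurable_fun setT f.
Proof.
move=> f1; apply: (measurability _ (RGenOpens.measurableE R)).
move=> _ [_ [a [b ->]] <-]; rewrite setTI; apply: open_measurable_cplane.
apply: open_cplane => z /= fz.
have : open `]a, b[%classic by exact: interval_open.
rewrite openE => /(_ _ fz) /nbhs_ballP[e /= e0 eab].
exists e => // w zw; apply: eab; apply: le_lt_trans zw.
exact: f1.
Qed.

Lemma measurable_Re : measurable_fun setT (fun z : cplane R => complex.Re (z : R[i])).
Proof. by apply: measurable_cplane => z w; rewrite -raddfB rnorm_Re_le. Qed.

Lemma measurable_Im : measurable_fun setT (fun z : cplane R => complex.Im (z : R[i])).
Proof. by apply: measurable_cplane => z w; rewrite -raddfB rnorm_Im_le. Qed.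

End ComplexPlane.

(** * Integrals of almost everywhere bounded functions *)

Section AeBounded.
Context d (T : measurableType d) (R : realType) (mu : {measure set T -> \bar R}).
Hypothesis mu_fin : (mu setT < +oo)%E.

Lemma ae_bounded_integrable (f : T -> R) (M : R) : measurable_fun setT f ->
  {ae mu, forall z, `|f z| <= M} -> mu.-integrable setT (EFin \o f).
Proof.
move=> mf fM; apply/integrableP; split; first exact/measurable_EFinP.
(* The absolute value of [M] is taken because the comparison needs a nonnegative constant, and [M]
   may be negative when [mu] is zero. *)
apply: (@le_lt_trans _ _ (\int[mu]_(z in setT) (cst `|M|%:E) z)%E).
  apply: ae_ge0_le_integral => //.
  - by apply: measurableT_comp => //; exact/measurable_EFinP.
  - by move=> z _; rewrite lee_fin.
  - by apply: filterS fM => z fz _; rewrite /= lee_fin (le_trans fz)// ler_norm.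
by rewrite integral_cst// lte_mul_pinfty// lee_fin.
Qed.

(** The constant [a] integrates to [a] times the total mass, and the integral of [f - a] is at most
    that of [r] in absolute value. *)
Lemma Rintegral_near_cst (f : T -> R) (a r : R) : 0 <= r -> measurable_fun setT f ->
  {ae mu, forall z, `|f z - a| <= r} ->
  `|\int[mu]_(z in setT) f z - a * fine (mu setT)| <= r * fine (mu setT).
Proof.
move=> r0 mf far.
have ic (c : R) : mu.-integrable setT (EFin \o cst c).
  by apply: (@ae_bounded_integrable _ `|c|) => //; exact: aeW.
have if_ : mu.-integrable setT (EFin \o f).
  apply: (@ae_bounded_integrable _ (r + `|a|)) => //.
  apply: filterS far => z zr; rewrite -[f z](subrK a).
  by apply: le_trans (ler_normD _ _) _; rewrite lerD2r.
rewrite -(Rintegral_cst mu measurableT) -RintegralB//; last exact: ic.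
have mfa : measurable_fun setT (fun z => f z - a) by exact: measurable_funB.
apply: le_trans (le_normr_Rintegral _ _) _ => //.
  exact: (@ae_bounded_integrable _ r).
rewrite -(Rintegral_cst mu measurableT) fine_le//.
- apply: integrable_fin_num => //.
  apply: (@ae_bounded_integrable _ r) => //; first exact: measurableT_comp.
  by apply: filterS far => z; rewrite normr_id.
- by apply: integrable_fin_num => //; exact: ic.
apply: ae_ge0_le_integral => //.
- by apply/measurable_EFinP; exact: measurableT_comp.
- by apply: filterS far => z zr _; rewrite lee_fin.
Qed.

Lemma Rintegral_measure_add (m1 m2 : {measure set T -> \bar R}) (f : T -> R) :
  (forall D, measurable D -> mu D = (m1 D + m2 D)%E) ->
  m1.-integrable setT (EFin \o f) -> m2.-integrable setT (EFin \o f) ->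
  \int[mu]_(z in setT) f z = \int[m1]_(z in setT) f z + \int[m2]_(z in setT) f z.
Proof.
move=> mE i1 i2; rewrite /Rintegral.
rewrite (eq_measure_integral (measure_add m1 m2)); last first.
  by move=> D mD _; rewrite mE//; symmetry; exact: measure_addE.
rewrite integral_measure_add//.
by rewrite [LHS]fineD//; exact: integrable_fin_num.
Qed.

End AeBounded.

(** * Scalar measures of a projection-valued measure *)

Section ProjectionMeasure.
Context {R : realType} {H : hilbertSpace R} (E : projectionMeasure H).
Implicit Types (u v x : H) (B D : set (cplane R)).

Lemma pvm_idem B u : measurable B -> E B (E B u) = E B u.
Proof. by move=> /(pvm_proj E)[+ _]; exact. Qed.

Lemma pvm_adj B u v : measurable B -> '[E B u, v] = '[u, E B v].
Proof. by move=> /(pvm_proj E)[_]; exact. Qed.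

Lemma pvm_dotp B u : measurable B -> '[E B u, u] = '[E B u, E B u].
Proof. by move=> mB; rewrite -(pvm_adj (E B u))// pvm_idem. Qed.

Lemma pvm_measure_rnorm B u : measurable B ->
  pvm_measure E u B = (rnorm (E B u) ^+ 2)%:E.
Proof. by move=> mB; rewrite pvm_measureE// pvm_dotp// dotp_normE. Qed.

Lemma pvm_measureT u : pvm_measure E u setT = (rnorm u ^+ 2)%:E.
Proof. by rewrite pvm_measure_rnorm// pvm_setT. Qed.

(** The projection of the complement of [B] kills [E B u = u], so the measure of [u] is carried by
    [B]. *)
Lemma pvm_fixed_ae B u (P : R[i] -> Prop) : measurable B -> E B u = u ->
  (forall z, B z -> P z) -> {ae pvm_measure E u, forall z, P z}.
Proof.
move=> mB Bu BP; exists (~` B); split; first exact: measurableC; last first.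
  by apply: subsetC => z; exact: BP.
have mCB := measurableC mB.
rewrite [LHS]pvm_measureE// -Bu.
have := pvm_setI E mCB mB u; rewrite setICl pvm_set0 /= => <-.
by rewrite linear0l.
Qed.

(** [E B] and [E D] commute, so the cross terms between [E B u] and [u - E B u] vanish. *)
Lemma pvm_measure_split B u D : measurable B -> measurable D ->
  pvm_measure E u D =
  (pvm_measure E (E B u) D + pvm_measure E (u - E B u)%R D)%E.
Proof.
move=> mB mD; rewrite !pvm_measureE// -EFinD -raddfD; congr (complex.Re _)%:E.
have DB : E D (E B u) = E B (E D u).
  by have := pvm_setI E mD mB u; rewrite setIC (pvm_setI E mB mD u)/=.
rewrite linearBr/= (linearB (E D))/= !linearBl/= DB.
rewrite -!(pvm_adj (E B (E D u)))// -(pvm_adj (E D u))//.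
by rewrite pvm_idem//; ring.
Qed.

Lemma pvm_splitT B u : measurable B ->
  rnorm u ^+ 2 = rnorm (E B u) ^+ 2 + rnorm (u - E B u) ^+ 2.
Proof.
move=> mB; have := pvm_measure_split u mB measurableT.
by rewrite !pvm_measureT -EFinD => -[].
Qed.

Lemma pvm_rnorm_le B u : measurable B -> rnorm (E B u) <= rnorm u.
Proof.
move=> mB; rewrite -(@ler_pXn2r _ 2) ?nnegrE ?rnorm_ge0//.
by rewrite (pvm_splitT u mB) lerDl sqr_ge0.
Qed.

Lemma pvm_measure_fin u : (pvm_measure E u setT < +oo)%E.
Proof. by rewrite pvm_measureT ltry. Qed.

End ProjectionMeasure.

(** * Commutation with the operator and localization on balls *)

Section SpectralMeasure.
Context {R : realType} {H : hilbertSpace R} (A : {linear H -> H}).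
Context (E : projectionMeasure H) (A_E : spectral_measure_of A E).
Implicit Types (u v x : H) (B D : set (cplane R)).

Lemma integrable_ReIm u :
  (pvm_measure E u).-integrable setT
    (EFin \o (fun z : cplane R => complex.Re (z : R[i]))) /\
  (pvm_measure E u).-integrable setT
    (EFin \o (fun z : cplane R => complex.Im (z : R[i]))).
Proof.
have [[r Er] _] := A_E.
have mr := measurable_closed_disc r.
split; apply: (ae_bounded_integrable (pvm_measure_fin E u) (M := r)).
- exact: measurable_Re.
- apply: (pvm_fixed_ae mr (Er u)) => z /= zr; rewrite -lecR.
  by apply: le_trans zr; exact: normc_ge_Re.
- exact: measurable_Im.
- apply: (pvm_fixed_ae mr (Er u)) => z /= zr; rewrite -lecR.
  by apply: le_trans zr; rewrite -(rnormE (z : R[i]^o)) lecR rnorm_Im_le.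
Qed.

(** The integral of [z] is additive in the measure, which splits along [E B]. *)
Lemma spectral_form_split B u : measurable B ->
  '[A u, u] = '[A (E B u), E B u] + '[A (u - E B u), u - E B u].
Proof.
move=> mB; have [_ Au] := A_E; rewrite !Au /complex_integral.
have mE D (mD : measurable D) := pvm_measure_split E u mB mD.
rewrite (Rintegral_measure_add mE (integrable_ReIm _).1 (integrable_ReIm _).1).
by rewrite (Rintegral_measure_add mE (integrable_ReIm _).2 (integrable_ReIm _).2).
Qed.

(** With [P = E B] and [Q = 1 - P], the splitting of the form says that [A - P A P - Q A Q] has zero
    form, hence vanishes: [A] is block diagonal. *)
Lemma spectral_projection_commute B u : measurable B -> A (E B u) = E B (A u).
Proof.
move=> mB.
pose P : {linear H -> H} := E B.
pose Q : {linear H -> H} := idfun \- P.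
pose S : {linear H -> H} := A \- (P \o A \o P) \- (Q \o A \o Q).
have SE v : S v = A v - P (A (P v)) - (A (v - P v) - P (A (v - P v))) by [].
have S0 : forall v, S v = 0.
  apply: form_eq0_linear => v; rewrite SE !dotpBl.
  rewrite (pvm_adj E (A (P v)) _ mB) (pvm_adj E (A (v - P v)) _ mB).
  by rewrite -dotpBr (spectral_form_split v mB) /P; ring.
(* The vanishing of [S] at [P u] reads [A P u = P A P u]; substituted into its vanishing at [u],
   this leaves [A P u = P A u]. *)
have PAP : A (P u) = P (A (P u)).
  have := S0 (P u); rewrite SE /P (pvm_idem E u mB) subrr.
  by rewrite (linear0 A) (linear0 (E B)) !subr0 => /eqP; rewrite subr_eq0 => /eqP.
have := S0 u; rewrite SE !(linearB A)/= !(linearB P)/= -PAP => /eqP.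
by rewrite subKr subr_eq0 => /eqP.
Qed.

(** The measure of [u] lives on the ball and has mass [|u|^2]; the real and imaginary parts of
    [z - w] contribute [r] each to the constant [2 r]. *)
Lemma spectral_ball_form (w : R[i]) (r : R) u : 0 <= r ->
  E (ball (w : R[i]^o) r%:C) u = u ->
  `|'[A u, u] - w * '[u, u]| <= (2 * r)%:C * '[u, u].
Proof.
move=> r0 Bu; have [_ Au] := A_E.
have mB := measurable_cplane_ball w r.
rewrite dotp_normE Au -(rnormE (_ : R[i]^o)) -rmorphM lecR.
apply: le_trans (rnorm_le_ReIm _) _.
have m2 : fine (pvm_measure E u setT) = rnorm u ^+ 2 by rewrite pvm_measureT.
have near := Rintegral_near_cst (pvm_measure_fin E u) r0.
have := near _ (complex.Re w) measurable_Re.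
have := near _ (complex.Im w) measurable_Im.
rewrite m2 => hI hR.
have {}hI := hI _; have {}hR := hR _.
rewrite mulr_natl mulr2n mulrDl; case: w {near} mB Bu hI hR => a b mB Bu hI hR.
rewrite /complex_integral/=.
rewrite !(mulr0, mul0r, subr0, addr0, add0r).
apply: lerD; [apply: hR|apply: hI]; apply: (pvm_fixed_ae mB Bu) => z.
  rewrite cplane_ballE /= => zr; apply: le_trans (ltW zr).
  by rewrite distrC; have := rnorm_Re_le ((a +i* b) - z); rewrite raddfB.
rewrite cplane_ballE /= => zr; apply: le_trans (ltW zr).
by rewrite distrC; have := rnorm_Im_le ((a +i* b) - z); rewrite raddfB.
Qed.

Lemma spectral_ball_near (w : R[i]) (r : R) u : 0 < r ->
  E (ball (w : R[i]^o) r%:C) u = u ->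
  rnorm (A u - w *: u) <= 4 * r * rnorm u.
Proof.
move=> r0 Bu; have mB := measurable_cplane_ball w r.
pose P : {linear H -> H} := E (ball (w : R[i]^o) r%:C).
(* The compression [P (A - w) P] satisfies the form bound at every vector and agrees with [A - w] at
   [u]. *)
pose S : {linear H -> H} := P \o (A \- w \*: idfun) \o P.
have SE v : S v = P (A (P v) - w *: P v) by [].
have -> : A u - w *: u = S u.
  rewrite SE /P Bu (linearB (E _)) (linearZ_LR (E _))/=.
  by rewrite -spectral_projection_commute// Bu.
(* [2 r] bounds the form; the other factor 2 is the price of passing to the norm. *)
have -> : 4 * r = 2 * (2 * r) by ring.
apply: numerical_radius_norm; first by rewrite mulr_gt0.
move=> v; rewrite SE (pvm_adj E (A (P v) - _) _ mB) dotpBl linearZl_LR/=.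
apply: le_trans (spectral_ball_form (ltW r0) (pvm_idem E v mB)) _.
rewrite ler_wpM2l//; first by rewrite lecR mulr_ge0// ltW.
by rewrite !dotp_normE lecR ler_pXn2r ?nnegrE ?rnorm_ge0// pvm_rnorm_le.
Qed.

End SpectralMeasure.

(** * Boundedness and growth of orbits *)

Lemma bessel_rnorm_bounded (R : realType) (H : hilbertSpace R) (y : nat -> H) :
  bessel_sequence y -> exists C : R, forall k, rnorm (y k) <= C.
Proof.
(* If [y k] is nonzero then [|y k|^2 <= C < (C + 1)^2]; the witness [C + 1] avoids a square root. *)
move=> [C C0 yC]; exists (C + 1) => k.
have h : rnorm (y k) ^+ 4 <= C * rnorm (y k) ^+ 2.
  rewrite -lee_fin; apply: le_trans (yC (y k)).
  (* Of the partial sum of length [k + 1] only the last term, of index [k], is kept. *)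
  apply: le_trans (nneseries_lim_ge k.+1 _); last first.
    by move=> n _ _; rewrite lee_fin sqr_ge0.
  rewrite big_nat_recr//= dotp_normE.
  have -> : rnorm ((rnorm (y k) ^+ 2)%:C : R[i]^o) = rnorm (y k) ^+ 2.
    by rewrite /rnorm normc_def/= expr0n/= addr0 sqrtr_sqr ger0_norm// sqr_ge0.
  by rewrite -exprM leeDr// sume_ge0// => n _; rewrite lee_fin sqr_ge0.
rewrite leNgt; apply/negP => Cy.
have y0 : 0 < rnorm (y k) by lra.
move: h; rewrite (exprD _ 2 2) ler_pM2r ?exprn_gt0// leNgt => /negP; apply.
by nra.
Qed.

(** Each step uses [|A v| >= |w| |v| - |A v - w v|] with [|A v - w v| <= 4 r |v|]. *)
Lemma rnorm_iter_ge (R : realType) (H : hilbertSpace R) (A : {linear H -> H})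
    (E : projectionMeasure H) (A_E : spectral_measure_of A E)
    (w : R[i]) (r : R) (x : H) : 0 < r -> 4 * r < rnorm (w : R[i]^o) ->
  E (ball (w : R[i]^o) r%:C) x = x ->
  forall k, (rnorm (w : R[i]^o) - 4 * r) ^+ k * rnorm x <= rnorm (iter k A x).
Proof.
move=> r0 wr Bx k.
have mB := measurable_cplane_ball w r.
(* The induction also carries that the orbit stays in the range of the projection, which commutation
   provides. *)
suff [] : (rnorm (w : R[i]^o) - 4 * r) ^+ k * rnorm x <= rnorm (iter k A x) /\
  E (ball (w : R[i]^o) r%:C) (iter k A x) = iter k A x by [].
elim: k => [|k [IH Bk]]; first by rewrite expr0 mul1r.
split; last by rewrite iterS -(spectral_projection_commute A_E)// Bk.
rewrite iterS exprS -mulrA.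
apply: le_trans (ler_wpM2l _ IH) _; first by rewrite subr_ge0 ltW.
have := spectral_ball_near A_E r0 Bk.
have := rnormB_ler (w *: iter k A x) (w *: iter k A x - A (iter k A x)).
rewrite subKr.
have -> : rnorm (w *: iter k A x - A (iter k A x)) =
  rnorm (A (iter k A x) - w *: iter k A x) by rewrite /rnorm distrC.
have -> : rnorm (w *: iter k A x) = rnorm (w : R[i]^o) * rnorm (iter k A x).
  by apply: complexI; rewrite rmorphM/= !rnormE normrZ.
by rewrite mulrBl; lra.
Qed.

Lemma geometric_unbounded (R : realType) (a b C : R) : 1 < a ->
  (forall k, a ^+ k * b <= C) -> b <= 0.
Proof.
move=> a1 abC; rewrite leNgt; apply/negP => b0.
have bern k : 1 + k%:R * (a - 1) <= a ^+ k.
  elim: k => [|k IH]; first by rewrite mul0r addr0 expr0.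
  rewrite exprS -natr1; apply: le_trans (ler_wpM2l _ IH); last by lra.
  have : 0 <= k%:R * (a - 1) ^+ 2 :> R by rewrite mulr_ge0// sqr_ge0.
  by rewrite mulrDl mul1r; lra.
(* For this [k], [k b (a - 1)] exceeds [C], while Bernoulli's inequality keeps it below
   [a^k b <= C]. *)
have [k Ck] : exists k : nat, C / (b * (a - 1)) < k%:R.
  exists (Num.bound `|C / (b * (a - 1))|).
  exact: le_lt_trans (ler_norm _) (archi_boundP (normr_ge0 _)).
have ba0 : 0 < b * (a - 1) by rewrite mulr_gt0// subr_gt0.
move: Ck; rewrite ltr_pdivrMr//.
have := abC k; have := ler_wpM2r (ltW b0) (bern k).
by lra.
Qed.

(** The condition on [w] makes the growth factor [|w| - 4 r] exceed 1. *)
Lemma bessel_ball_eq0 (R : realType) (H : hilbertSpace R) (A : {linear H -> H})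
    (E : projectionMeasure H) (A_E : spectral_measure_of A E)
    (x : H) (w : R[i]) (r : R) :
  bessel_sequence (fun k : nat => iter k A x) ->
  0 < r -> 1 + 4 * r < rnorm (w : R[i]^o) ->
  pvm_measure E x (ball (w : R[i]^o) r%:C) = 0%E.
Proof.
move=> /bessel_rnorm_bounded[C xC] r0 wr.
have mB := measurable_cplane_ball w r.
rewrite pvm_measure_rnorm//.
suff : rnorm (E (ball (w : R[i]^o) r%:C) x) <= 0.
  by move=> h; congr EFin; apply/eqP; rewrite sqrf_eq0 eq_le h rnorm_ge0.
apply: (@geometric_unbounded _ (rnorm (w : R[i]^o) - 4 * r) _ C); first by lra.
move=> k; apply: le_trans (rnorm_iter_ge A_E r0 _ (pvm_idem E x mB) k) _; first by lra.
(* By commutation the orbit of the projected vector is the projection of the orbit of [x], hence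
   bounded by [C]. *)
suff -> : iter k A (E (ball (w : R[i]^o) r%:C) x) =
   E (ball (w : R[i]^o) r%:C) (iter k A x).
  by apply: le_trans (xC k); exact: pvm_rnorm_le.
by elim: k => //= k ->; rewrite (spectral_projection_commute A_E).
Qed.

(** * Covering the complement of the disc by null balls *)

Lemma cplane_ball_cover (R : realType) (z : R[i]) (r : R) : 0 < r ->
  exists ij : int * int,
    ball ((ij.1%:~R * r) +i* (ij.2%:~R * r) : R[i]^o) (2 * r)%:C z.
Proof.
(* Rounding both coordinates down to the grid of mesh [r] moves each by less than [r]. *)
move=> r0; exists (Num.floor (complex.Re z / r), Num.floor (complex.Im z / r)).
rewrite cplane_ballE/=; apply: le_lt_trans (rnorm_le_ReIm _) _.
have fl (a : R) : `|(Num.floor (a / r))%:~R * r - a| < r.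
  have := Num.Theory.floor_itv (a / r) => /andP[].
  rewrite ler_pdivlMr// ltr_pdivrMr// intrD mulrDl mul1r => h1 h2.
  by rewrite ltr_norml; apply/andP; split; lra.
by case: z => a b /=; rewrite mulrDl mul1r ltrD.
Qed.

Lemma bessel_outside_disc_eq0 (R : realType) (H : hilbertSpace R) (A : {linear H -> H})
    (E : projectionMeasure H) (A_E : spectral_measure_of A E) (x : H) :
  bessel_sequence (fun k : nat => iter k A x) ->
  pvm_measure E x [set z : R[i] | 1 < rnorm (z : R[i]^o)] = 0%E.
Proof.
move=> xB.
(* [t = (n, (i, j))] codes the grid point of indices [i], [j] at mesh [1 / (n + 1)]. *)
pose c (t : nat * (int * int)) : R[i] :=
  (t.2.1%:~R * t.1.+1%:R^-1) +i* (t.2.2%:~R * t.1.+1%:R^-1).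
(* Balls too close to the disc for their radius are replaced by the empty set, so that every [F k]
   is null. *)
pose F k : set (cplane R) := if unpickle k is Some t then
  if 1 + 4 * (2 * t.1.+1%:R^-1) < rnorm (c t : R[i]^o)
  then ball (c t : R[i]^o) (2 * t.1.+1%:R^-1)%:C else set0 else set0.
apply: measure_negligible; first exact: (open_measurable_cplane (@open_rnorm_gt R 1)).
apply: (@negligibleS _ _ _ _ (\bigcup_k F k)); last first.
  apply: negligible_bigcup => k; rewrite /F.
  case: unpickle => [t|]; last exact: negligible_set0.
  case: ifPn => [ct|_]; last exact: negligible_set0.
  apply/negligibleP; first exact: measurable_cplane_ball.
  by apply: (bessel_ball_eq0 A_E) => //; rewrite mulr_gt0// invr_gt0.
suff cover (z : R[i]) : 1 < rnorm (z : R[i]^o) -> (\bigcup_k F k) z by exact: cover.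
(* At mesh [s = 1 / (n + 1)] the centre must have modulus above [1 + 8 s] and lies within [2 s] of
   [z], so [10 s < |z| - 1] suffices. *)
move=> z1; have [n nz] : exists n : nat, 10 / (rnorm (z : R[i]^o) - 1) < n%:R.
  by eexists; exact: le_lt_trans (ler_norm _) (archi_boundP (normr_ge0 _)).
have n0 : 0 < n.+1%:R^-1 :> R by rewrite invr_gt0.
have [ij zij] := cplane_ball_cover z n0.
exists (pickle (n, ij)) => //; rewrite /F pickleK.
rewrite ifT//.
have := zij; rewrite cplane_ballE /= => zc.
apply: (rnorm_gt_near zc).
have : 10 * n.+1%:R^-1 < rnorm (z : R[i]^o) - 1; last first.
  by move: (rnorm _) (_^-1) => s t; lra.
rewrite ltr_pdivrMr// mulrC.
move: nz; rewrite ltr_pdivrMr ?subr_gt0// => nz; apply: lt_le_trans nz _.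
by rewrite -natr1; lra.
Qed.

Theorem lemma2p2 (R : realType) (H : hilbertSpace R) (A : {linear H -> H})
    (A_bounded : bounded_operator A) (A_normal : normal_operator A)
    (E : projectionMeasure H) (A_E : spectral_measure_of A E)
    (x : H) (x_bessel : bessel_sequence (fun k : nat => iter k A x)) :
  range (E (closed_unit_disc R)) x /\
  measure_support (pvm_measure E x) `<=` closed_unit_disc R.
Proof.
have outside0 := bessel_outside_disc_eq0 A_E x_bessel.
have DE : closed_unit_disc R = [set z | `|z| <= 1%:C] by [].
split; last first.
  (* The complement of the disc is open and null, so it contains no point of the support. *)
  move=> z /(_ _ (@open_rnorm_gt R 1)) zsupp.
  rewrite DE closed_discE => z1; move: (zsupp z1).
  by rewrite outside0 ltxx.
exists x => //; rewrite DE closed_discE.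
have mO := open_measurable_cplane (@open_rnorm_gt R 1).
have mC := measurableC mO.
have : pvm_measure E x setT =
    (pvm_measure E x [set z : R[i] | (1 < rnorm (z : R[i]^o))%R] +
     pvm_measure E x (~` [set z : R[i] | (1 < rnorm (z : R[i]^o))%R]))%E.
  rewrite -measureU//; last exact: setICr.
  by rewrite setUv.
(* The disc carries all the mass [|x|^2], so by Pythagoras the component of [x] orthogonal to the
   range is zero. *)
rewrite outside0 add0e pvm_measureT pvm_measure_rnorm// => -[].
rewrite (pvm_splitT E x mC) => /eqP.
rewrite -[X in _ == X]addr0 => /eqP/addrI/eqP; rewrite sqrf_eq0 => /eqP h.
by apply/esym/eqP; rewrite -subr_eq0 -normr_eq0 -rnormE h.
Qed.
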